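(* Let $D\subset\mathbb{R}^{n+1}$ be a domain with upper base $\gamma(D)$, and let $F:D\times\mathbb{R}\times\mathbb{R}^n\times\mathcal{S}_n\to\mathbb{R}$ satisfy the structure condition (S) below with constants $0<\lambda\le\Lambda$ and bounded continuous functions $b\ge 0$, $c\le 0$ on $D$, together with $F(x,t,0,0,0)=0$ on $D$. Let $u$ be a continuous viscosity subsolution (resp. supersolution) of $$F(x,t,u,Du,D^2u)-\partial_t u=0$$ in $D\cup\gamma(D)$, and suppose $u$ attains a nonnegative maximum (resp. nonpositive minimum) $M$ over $D\cup\gamma(D)$ at some point $(x_0,t_0)\in D\cup\gamma(D)$. Then $u\equiv M$ in the subdomain of $D$ subordinate to $(x_0,t_0)$, i.e. $u(x',t')=M$ at every point $(x',t')\in D$ which can be joined to $(x_0,t_0)$ by a broken line lying in $D\cup\gamma(D)$ (except possibly at $(x_0,t_0)$), uniquely projected onto the $t$-axis, and having $(x_0,t_0)$ as its upper end-point.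
   Context: $\mathcal{S}_n$ denotes the space of real symmetric $n\times n$ matrices; for $N\ge 0$, $\|N\|=\mathrm{Tr}(N)$. Structure condition (S): for all $(x,t)\in D$, $r,s\in\mathbb{R}$, $p,q\in\mathbb{R}^n$, $M,N\in\mathcal{S}_n$ with $N\ge 0$, $$\lambda\|N\|-b(x,t)|p-q|+c(x,t)(r-s)\le F(x,t,r,p,M+N)-F(x,t,s,q,M)\le \Lambda\|N\|+b(x,t)|p-q|+c(x,t)(r-s).$$ (Consequently, viscosity subsolutions satisfy $\mathcal{M}^+_{\lambda,\Lambda}(D^2u)+b|Du|+cu-\partial_tu\ge0$ and supersolutions satisfy $\mathcal{M}^-_{\lambda,\Lambda}(D^2u)-b|Du|+cu-\partial_tu\le0$ in the viscosity sense, where $\mathcal{M}^+_{\lambda,\Lambda}(X)=\sup_{\lambda I\le A\le\Lambda I}\mathrm{Tr}(AX)$, $\mathcal{M}^-_{\lambda,\Lambda}(X)=\inf_{\lambda I\le A\le\Lambda I}\mathrm{Tr}(AX)$.) Cylinders: $\mathbb{Q}^{t_1,t_2}_{x,R}=\{(y,s):|y-x|<R,\ t_1<s<t_2\}$. Upper base $\gamma(D)$: the set of points $(x,t)\in\partial D$ for which there is $h>0$ such that $\mathbb{Q}^{t-h,t}_{x,h}\subset D$ while $\mathbb{Q}^{t,t+h}_{x,h}$ lies outside $D$. Being a viscosity subsolution (supersolution) in $D\cup\gamma(D)$ means the viscosity inequalities hold also at points of $\gamma(D)$ (tested with functions touching from the past side, as usual for parabolic problems up to the terminal time).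
   Formalization: Since the viscosity inequality is imposed on γ(D), where F is not defined as stated, F, b, c are taken on D∪γ(D), and (S), F(x,t,0,0,0)=0, b≥0, c≤0 and boundedness of b, c are required there as well. *)

(* Defs.v *)
From mathcomp Require Import all_boot all_order all_algebra.
From mathcomp Require Import all_classical all_reals all_analysis.
Set Implicit Arguments. Unset Strict Implicit. Unset Printing Implicit Defensive.
Import Order.TTheory GRing.Theory Num.Theory numFieldNormedType.Exports.
Local Open Scope classical_set_scope.
Local Open Scope ring_scope.

(* Space-time R^{n+1} = R^n x R; a point is a pair (x, t). *)
Notation spt R n := (matrix (Real.sort R) 1 n * Real.sort R)%type (only parsing).

(* Euclidean norm on R^n (the MathComp norm on 'rV_n is the sup norm). *)
Definition enorm (R : realType) (n : nat) (p : 'rV[R]_n) : R :=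
  Num.sqrt (\sum_(i < n) p ord0 i ^+ 2).

Definition cyl (R : realType) (n : nat) (x : 'rV[R]_n) (r t1 t2 : R) : set (spt R n) :=
  [set z | enorm (z.1 - x) < r /\ t1 < z.2 < t2].

Definition upper_base (R : realType) (n : nat) (D : set (spt R n)) : set (spt R n) :=
  [set z | topology_structure.closure D z /\ ~ interior D z /\
     exists2 h : R, 0 < h &
       cyl z.1 h (z.2 - h) z.2 `<=` D /\ cyl z.1 h z.2 (z.2 + h) `<=` ~` D].

(* Symmetric and positive semidefinite matrices; ||N|| = Tr N. *)
Definition symmx (R : realType) (n : nat) (M : 'M[R]_n) : Prop := M^T = M.
Definition psdmx (R : realType) (n : nat) (N : 'M[R]_n) : Prop :=
  forall v : 'rV[R]_n, 0 <= (v *m N *m v^T) ord0 ord0.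

Definition structure_S (R : realType) (n : nat) (E : set (spt R n))
  (F : spt R n -> R -> 'rV[R]_n -> 'M[R]_n -> R) (lam Lam : R)
  (b c : spt R n -> R) : Prop :=
  forall z, E z -> forall (r s : R) (p q : 'rV[R]_n) (M N : 'M[R]_n),
    symmx M -> symmx N -> psdmx N ->
    lam * \tr N - b z * enorm (p - q) + c z * (r - s)
      <= F z r p (M + N) - F z s q M
    /\ F z r p (M + N) - F z s q M
      <= Lam * \tr N + b z * enorm (p - q) + c z * (r - s).

Definition xdir (R : realType) (n : nat) (i : 'I_n) : spt R n :=
  (delta_mx ord0 i, 0).
Definition tdir (R : realType) (n : nat) : spt R n := (0, 1).

Definition dx (R : realType) (n : nat) (phi : spt R n -> R) (i : 'I_n) : spt R n -> R :=
  fun z => 'D_(@xdir R n i) phi z.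
Definition dt (R : realType) (n : nat) (phi : spt R n -> R) : spt R n -> R :=
  fun z => 'D_(@tdir R n) phi z.

Definition grad (R : realType) (n : nat) (phi : spt R n -> R) (z : spt R n) : 'rV[R]_n :=
  \row_i dx phi i z.
Definition hess (R : realType) (n : nat) (phi : spt R n -> R) (z : spt R n) : 'M[R]_n :=
  \matrix_(i, j) dx (dx phi i) j z.

Definition C21_near (R : realType) (n : nat) (phi : spt R n -> R) (z : spt R n) : Prop :=
  exists2 r : R, 0 < r & forall w : spt R n, ball z r w ->
    [/\ (forall i, derivable phi w (@xdir R n i)),
        (forall i j, derivable (dx phi i) w (@xdir R n j)),
        derivable phi w (@tdir R n),
        ({for w, continuous phi} /\ {for w, continuous (dt phi)}) &
        (forall i, {for w, continuous (dx phi i)}) /\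
        (forall i j, {for w, continuous (dx (dx phi i) j)})].

Definition touches_above (R : realType) (n : nat) (E : set (spt R n))
  (u phi : spt R n -> R) (z : spt R n) : Prop :=
  \forall w \near z, E w -> u w - phi w <= u z - phi z.
Definition touches_below (R : realType) (n : nat) (E : set (spt R n))
  (u phi : spt R n -> R) (z : spt R n) : Prop :=
  \forall w \near z, E w -> u z - phi z <= u w - phi w.

Definition visc_sub (R : realType) (n : nat) (E : set (spt R n))
  (F : spt R n -> R -> 'rV[R]_n -> 'M[R]_n -> R) (u : spt R n -> R) : Prop :=
  forall z phi, E z -> C21_near phi z -> touches_above E u phi z ->
    0 <= F z (u z) (grad phi z) (hess phi z) - dt phi z.
Definition visc_super (R : realType) (n : nat) (E : set (spt R n))
  (F : spt R n -> R -> 'rV[R]_n -> 'M[R]_n -> R) (u : spt R n -> R) : Prop :=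
  forall z phi, E z -> C21_near phi z -> touches_below E u phi z ->
    F z (u z) (grad phi z) (hess phi z) - dt phi z <= 0.

Definition seg (R : realType) (n : nat) (a b : spt R n) (l : R) : spt R n :=
  ((1 - l) *: a.1 + l *: b.1, (1 - l) * a.2 + l * b.2).

(* z is subordinate to z0 w.r.t. E: z is joined to z0 by a broken line with
   vertices v 0 = z0, ..., v k = z, whose time coordinate strictly decreases
   along the line (so it projects injectively onto the t-axis and z0 is its
   upper end-point), and all of whose points other than z0 lie in E. *)
Definition subordinate (R : realType) (n : nat) (E : set (spt R n))
  (z0 z : spt R n) : Prop :=
  exists (k : nat) (v : nat -> spt R n),
    [/\ v 0%N = z0, v k = z &
      forall i : nat, (i < k)%N ->
        (v i.+1).2 < (v i).2 /\
        forall l : R, 0 <= l <= 1 -> seg (v i) (v i.+1) l <> z0 ->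
          E (seg (v i) (v i.+1) l)].

(* Main.v *)
Require Import Defs.
From mathcomp Require Import all_boot all_order all_algebra.
From mathcomp Require Import all_classical all_reals all_analysis.
From mathcomp Require Import ring lra.
Import Order.TTheory GRing.Theory Num.Theory numFieldNormedType.Exports.
Local Open Scope classical_set_scope.
Local Open Scope ring_scope.
Set Implicit Arguments.
Unset Strict Implicit.
Unset Printing Implicit Defensive.

(** Suppose [u = M] at the upper end of a segment with axis
    [xi t = a + (t - t1) k] but [u < M] at its lower end, hence on a small ball
    around it.  In a thin slanted tube around the segment, with
    [g = rho^2 - |x - xi t|^2], the barrier
    [W = eps exp (- al (t - t1)) g^2 - kap (t - t1)] is for large [al] a strict
    subsolution of the extremal equation satisfied by [M - u], so [u + W]
    cannot have a maximum larger than [M] at a point of the tube off its bottom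
    and its lateral boundary.  For small [eps] it is at most [M] on the bottom
    and on the lateral boundary, but it exceeds [M] at the upper end of the
    segment: a contradiction.  The Hessian of [W] is a multiple of
    [y (x) y] minus a multiple of the identity, so the structure condition
    applies to it without diagonalisation.  If the upper end lies in [D], the
    tube is continued beyond it and [kap] excludes maxima at the top; if it lies
    on the upper base, the viscosity inequality holds at the top. *)

(** A directional derivative depends only on the restriction to a line, so the barrier can be
    differentiated with one-variable calculus. *)
Lemma is_derive_line (R : numFieldType) (V W : normedModType R) (f : V -> W)
  (x v : V) (df : W) :
  is_derive (0 : R) 1 (fun h : R => f (h *: v + x)) df -> is_derive x v f df.
Proof.
case=> dv <-; split; first exact: (derivable1P f x v).2.
rewrite /derive; set g1 := fun h => h^-1 *: _; set g2 := fun h => h^-1 *: _.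
suff -> : g1 = g2 by [].
by rewrite funeqE /g1 /g2 => h /=; rewrite addr0 scale0r add0r [_%:A]mulr1.
Qed.

Lemma scaleRE (R : realType) (r x : R) : r *: x = r * x.
Proof. by []. Qed.

(** * The barrier, its derivatives and their continuity *)

Section Barrier.
Variables (R : realType) (n : nat).
Implicit Types (x y : 'rV[R]_n) (z w v : spt R n).

Definition dot x y : R := \sum_(i < n) x ord0 i * y ord0 i.

Lemma dotDr x y y' : dot x (y + y') = dot x y + dot x y'.
Proof.
by rewrite /dot -big_split; apply: eq_bigr => i _; rewrite mxE mulrDr.
Qed.

Lemma dotC x y : dot x y = dot y x.
Proof. by apply: eq_bigr => i _; rewrite mulrC. Qed.

Lemma dotZr (r : R) x y : dot x (r *: y) = r * dot x y.
Proof.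
by rewrite /dot mulr_sumr; apply: eq_bigr => i _; rewrite mxE mulrCA.
Qed.

Lemma dotDl x y y' : dot (y + y') x = dot y x + dot y' x.
Proof. by rewrite dotC dotDr !(dotC x). Qed.

Lemma dotZl (r : R) x y : dot (r *: y) x = r * dot y x.
Proof. by rewrite dotC dotZr (dotC x). Qed.

Lemma dot_delta x i : dot x (delta_mx ord0 i) = x ord0 i.
Proof.
rewrite /dot (bigD1 i) //= big1 ?addr0; first by rewrite mxE !eqxx mulr1.
by move=> j /negPf ji; rewrite mxE ji andbF mulr0.
Qed.

Lemma dot_ge0 x : 0 <= dot x x.
Proof. by apply: sumr_ge0 => i _; rewrite -expr2 sqr_ge0. Qed.

Lemma dot_le_half x y : dot x y <= (dot x x + dot y y) / 2.
Proof.
have := dot_ge0 (x + (-1) *: y).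
rewrite dotDl !dotDr !dotZl !dotZr (dotC y x); lra.
Qed.

Lemma enormE x : enorm x = Num.sqrt (dot x x).
Proof. by []. Qed.

Lemma enormZ (r : R) x : 0 <= r -> enorm (r *: x) = r * enorm x.
Proof.
move=> r0; rewrite !enormE dotZl dotZr mulrA -expr2 sqrtrM ?sqr_ge0 //.
by rewrite sqrtr_sqr ger0_norm.
Qed.

Lemma enorm_lt x (h : R) : 0 < h -> (enorm x < h) = (dot x x < h ^+ 2).
Proof.
move=> h0; rewrite enormE -[in LHS](ger0_norm (ltW h0)) -sqrtr_sqr.
by rewrite ltr_sqrt ?exprn_gt0.
Qed.

Lemma enorm_le x (h : R) : 0 <= h -> dot x x <= h ^+ 2 -> enorm x <= h.
Proof.
move=> h0 xh; rewrite enormE -(ger0_norm h0) -sqrtr_sqr.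
by rewrite ler_sqrt ?sqr_ge0.
Qed.

Variables (a k : 'rV[R]_n) (t1 rho al : R).

(** [disp z] is the spatial offset of [z] from the point of the slanted axis at the same time; [gap]
    is positive inside the tube of radius [rho] and vanishes on its lateral boundary. *)
Definition disp z : 'rV[R]_n := z.1 - a - (z.2 - t1) *: k.
Definition gap z : R := rho ^+ 2 - dot (disp z) (disp z).
Definition decay z : R := expR (- al * (z.2 - t1)).
Definition barrier (eps kap : R) z : R :=
  eps * decay z * gap z ^+ 2 - kap * (z.2 - t1).

Definition barrier_dx (eps : R) (i : 'I_n) z : R :=
  - 4 * eps * decay z * gap z * disp z ord0 i.
Definition barrier_dxx (eps : R) (i j : 'I_n) z : R :=
  eps * decay z * (8 * disp z ord0 i * disp z ord0 j - 4 * gap z * (i == j)%:R).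
Definition barrier_dt (eps kap : R) z : R :=
  eps * decay z * (- al * gap z ^+ 2 + 4 * gap z * dot (disp z) k) - kap.

Lemma disp_line z v (h : R) :
  disp (h *: v + z) = disp z + h *: (v.1 - v.2 *: k).
Proof.
rewrite /disp /=; apply/rowP => i; rewrite !mxE /GRing.scale /=; ring.
Qed.

(** As [disp] is affine, [gap] becomes a quadratic polynomial along a line, just as [decay] becomes
    an exponential. *)
Lemma gap_line z v (h : R) (e := v.1 - v.2 *: k) :
  gap (h *: v + z) = gap z + h * (- 2 * dot (disp z) e) + h ^+ 2 * - dot e e.
Proof.
rewrite /gap disp_line -/e; move: (disp z) e => y e.
rewrite dotDl !dotDr !dotZl !dotZr (dotC e y); ring.
Qed.

Lemma decay_line z v (h : R) :
  decay (h *: v + z) = decay z * expR (h * (- al * v.2)).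
Proof.
by rewrite /decay -expRD /= /GRing.scale /=; congr expR; ring.
Qed.

Lemma is_derive_quadratic (p q r : R) :
  is_derive (0 : R) 1 (fun h : R => p + h * q + h ^+ 2 * r) q.
Proof.
pose f : R -> R := cst p + q *: id + r *: (id ^+ 2).
have -> : (fun h : R => p + h * q + h ^+ 2 * r) = f.
  by apply/funext => h; rewrite /f /= !fctE /GRing.scale /=; ring.
apply: is_derive_eq; rewrite /GRing.scale /=; ring.
Qed.

Lemma is_derive_affine (p q : R) :
  is_derive (0 : R) 1 (fun h : R => p + h * q) q.
Proof.
have := is_derive_quadratic p q 0.
by congr is_derive; apply/funext => h; rewrite mulr0 addr0.
Qed.

Lemma is_derive_expR_line (p : R) :
  is_derive (0 : R) 1 (fun h : R => expR (h * p)) p.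
Proof.
have H : is_derive (0 : R) 1 (fun h : R => h * p) p.
  have := is_derive_affine 0 p.
  by congr is_derive; apply/funext => h; rewrite add0r.
have := @is_derive1_comp _ expR (fun h : R => h * p) 0 _ _ (is_derive_expR _) H.
by rewrite mul0r expR0 mul1r.
Qed.

Lemma is_derive_barrier (eps kap : R) z v :
  is_derive z v (barrier eps kap)
    (eps * decay z * (- al * v.2 * gap z ^+ 2
       - 4 * gap z * dot (disp z) (v.1 - v.2 *: k)) - kap * v.2).
Proof.
apply: is_derive_line; set e := v.1 - v.2 *: k.
set p := gap z; set q := - 2 * dot (disp z) e; set r := - dot e e.
have P := is_derive_quadratic p q r.
have X := is_derive_expR_line (- al * v.2).
have A := is_derive_affine (- (kap * (z.2 - t1))) (- (kap * v.2)).
have /= M := is_deriveD (is_deriveZ (eps * decay z)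
  (is_deriveM X (is_deriveM P P))) A.
pose Q (h : R) := p + h * q + h ^+ 2 * r.
(* The same derivative with the operations on functions unfolded pointwise, to match the barrier
   restricted to the line. *)
have {}M : is_derive (0 : R) 1
    (fun h : R => eps * decay z * (expR (h * (- al * v.2)) * (Q h * Q h))
       + (- (kap * (z.2 - t1)) + h * - (kap * v.2)))
    (eps * decay z * (expR (0 * (- al * v.2)) * (Q 0 * q + Q 0 * q)
       + Q 0 * Q 0 * (- al * v.2)) - kap * v.2) := M.
have -> : (fun h : R => barrier eps kap (h *: v + z)) =
    (fun h : R => eps * decay z * (expR (h * (- al * v.2)) * (Q h * Q h))
       + (- (kap * (z.2 - t1)) + h * - (kap * v.2))).
  apply/funext => h; rewrite /barrier decay_line gap_line -/e -/p -/q -/r.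
  by rewrite -/(Q h) /= scaleRE; ring.
apply: (is_derive_eq M); rewrite mul0r expR0 /Q /q; ring.
Qed.

Lemma is_derive_barrier_dx (eps : R) (i j : 'I_n) z :
  is_derive z (@xdir R n j) (barrier_dx eps i) (barrier_dxx eps i j z).
Proof.
apply: is_derive_line.
set p := gap z; set q := - 2 * dot (disp z) (delta_mx ord0 j).
set r := - dot (delta_mx ord0 j) (delta_mx ord0 j : 'rV[R]_n).
have P := is_derive_quadratic p q r.
have A := is_derive_affine (disp z ord0 i) (i == j)%:R.
pose Q (h : R) := p + h * q + h ^+ 2 * r.
pose L (h : R) := disp z ord0 i + h * (i == j)%:R.
have M : is_derive (0 : R) 1 (fun h : R => - 4 * eps * decay z * (Q h * L h))
    (- 4 * eps * decay z * (Q 0 * (i == j)%:R + L 0 * q)) :=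
  is_deriveZ (- 4 * eps * decay z) (is_deriveM P A).
have -> : (fun h : R => barrier_dx eps i (h *: xdir R j + z)) =
    (fun h : R => - 4 * eps * decay z * (Q h * L h)).
  apply/funext => h; rewrite /barrier_dx decay_line gap_line disp_line /=.
  rewrite scale0r subr0 -/p -/q -/r mulr0 mulr0 expR0 !mxE eqxx /=.
  by rewrite /Q /L /disp !mxE; ring.
apply: (is_derive_eq M); rewrite /Q /L /barrier_dxx /q dot_delta -/p; ring.
Qed.

(** Equality of functions, rather than at one point, permits rewriting under a second [dx]. *)
Lemma dx_barrier (eps kap : R) (i : 'I_n) :
  dx (barrier eps kap) i = barrier_dx eps i.
Proof.
apply/funext => z; rewrite /dx.
have [_ ->] := is_derive_barrier eps kap z (xdir R i).
by rewrite /= scale0r subr0 dot_delta /barrier_dx; ring.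
Qed.

Lemma dxx_barrier (eps kap : R) (i j : 'I_n) :
  dx (dx (barrier eps kap) i) j = barrier_dxx eps i j.
Proof.
rewrite dx_barrier; apply/funext => z; rewrite /dx.
by have [_ ->] := is_derive_barrier_dx eps i j z.
Qed.

Lemma dt_barrier (eps kap : R) :
  dt (barrier eps kap) = barrier_dt eps kap.
Proof.
apply/funext => z; rewrite /dt.
have [_ ->] := is_derive_barrier eps kap z (tdir R n).
rewrite /= scale1r sub0r -(scaleN1r k) dotZr /barrier_dt; ring.
Qed.

Lemma continuous_dot_comp (T : topologicalType) (f g : T -> 'rV[R]_n) (s : T) :
  {for s, continuous f} -> {for s, continuous g} ->
  {for s, continuous (fun s => dot (f s) (g s))}.
Proof.
move=> cf cg; rewrite /dot.
have H i : f s' ord0 i * g s' ord0 i @[s' --> s] --> f s ord0 i * g s ord0 i.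
  apply: cvgM; [apply: (@continuous_comp _ _ _ f (fun M => M ord0 i) s cf)
    | apply: (@continuous_comp _ _ _ g (fun M => M ord0 i) s cg)];
  exact: coord_continuous.
exact: (cvg_big (@add_continuous R)).
Qed.

Lemma continuous_disp : continuous disp.
Proof.
move=> z; apply: cvgB; first by apply: cvgB; [exact: cvg_fst | exact: cvg_cst].
apply: cvgZr_tmp; apply: cvgB; [exact: cvg_snd | exact: cvg_cst].
Qed.

Lemma continuous_gap : continuous gap.
Proof.
move=> z; apply: cvgB; first exact: cvg_cst.
by apply: continuous_dot_comp; exact: continuous_disp.
Qed.

Lemma continuous_decay : continuous decay.
Proof.
move=> z; apply: continuous_comp; last exact: continuous_expR.
apply: cvgMl_tmp; apply: cvgB; [exact: cvg_snd | exact: cvg_cst].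
Qed.

Lemma continuous_barrier (eps kap : R) : continuous (barrier eps kap).
Proof.
move=> z; apply: cvgB; last first.
  by apply: cvgMl_tmp; apply: cvgB; [exact: cvg_snd | exact: cvg_cst].
apply: cvgM; first by apply: cvgMl_tmp; exact: continuous_decay.
apply: cvgM; exact: continuous_gap.
Qed.

Lemma C21_near_barrier (eps kap : R) z : C21_near (barrier eps kap) z.
Proof.
have cg := continuous_gap; have cd := continuous_decay.
have cc i : continuous (fun z => disp z ord0 i).
  move=> w; apply: (@continuous_comp _ _ _ disp (fun M => M ord0 i)).
    exact: continuous_disp.
  exact: coord_continuous.
exists 1 => // w _; split.
- by move=> i; case: (is_derive_barrier eps kap w (xdir R i)).
- move=> i j; rewrite dx_barrier.
  by case: (is_derive_barrier_dx eps i j w).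
- by case: (is_derive_barrier eps kap w (tdir R n)).
- split; first exact: continuous_barrier.
  rewrite dt_barrier; apply: cvgB; last exact: cvg_cst.
  apply: cvgM; first by apply: cvgMl_tmp; exact: cd.
  apply: cvgD; first by apply: cvgMl_tmp; apply: cvgM; exact: cg.
  apply: cvgM; first by apply: cvgMl_tmp; exact: cg.
  by apply: continuous_dot_comp; [exact: continuous_disp | exact: cvg_cst].
- split=> [i|i j].
    rewrite dx_barrier; apply: cvgM; last exact: cc.
    by apply: cvgM; [apply: cvgMl_tmp; exact: cd | exact: cg].
  rewrite dxx_barrier; apply: cvgM; first by apply: cvgMl_tmp; exact: cd.
  apply: cvgB; last by apply: cvgMr_tmp; apply: cvgMl_tmp; exact: cg.
  by apply: cvgM; [apply: cvgMl_tmp; exact: cc | exact: cc].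
Qed.

End Barrier.

(** * Extremal bounds from the structure condition *)

Section ExtremalBounds.
Variables (R : realType) (n : nat).
Variables (E : set (spt R n)) (F : spt R n -> R -> 'rV[R]_n -> 'M[R]_n -> R).
Variables (lam Lam : R) (b c : spt R n -> R).
Hypothesis FS : structure_S E F lam Lam b c.
Hypothesis F0 : forall z, E z -> F z 0 0 0 = 0.

Lemma enorm0 : enorm (0 : 'rV[R]_n) = 0.
Proof.
rewrite enormE (_ : dot _ _ = 0) ?sqrtr0 //.
by rewrite -(scale0r 0) dotZl mul0r.
Qed.

(** The structure condition is used twice with base matrix [- Q]: adding [P] leads to [P - Q], and
    adding [Q] leads to [F z 0 0 0 = 0]. Eliminating [F z 0 0 (- Q)] gives both bounds. *)
Lemma extremal_bounds z (r : R) (p : 'rV[R]_n) (P Q : 'M[R]_n) : E z ->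
  symmx P -> psdmx P -> symmx Q -> psdmx Q ->
  lam * \tr P - Lam * \tr Q - b z * enorm p + c z * r <= F z r p (P - Q) /\
  F z r p (P - Q) <= Lam * \tr P - lam * \tr Q + b z * enorm p + c z * r.
Proof.
move=> Ez sP pP sQ pQ.
have sNQ : symmx (- Q) by rewrite /symmx linearN /= sQ.
have := FS Ez r 0 p 0 sNQ sP pP.
have := FS Ez 0 0 0 0 sNQ sQ pQ.
rewrite addNr F0 // !subr0 enorm0 (addrC (- Q)).
by move: (F z 0 0 (- Q)) => f0 [? ?] [? ?]; split; lra.
Qed.

End ExtremalBounds.

(** * Testing viscosity solutions with the barrier *)

Section BarrierTest.
Variables (R : realType) (n : nat).
Implicit Types (z w : spt R n) (d : 'rV[R]_n).

Lemma symmx_scalar (r : R) : @symmx R n r%:M.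
Proof. exact: tr_scalar_mx. Qed.

Lemma psdmx_scalar (r : R) : 0 <= r -> @psdmx R n r%:M.
Proof.
move=> r0 v; rewrite mul_mx_scalar -scalemxAl mxE mulr_ge0 // mxE.
by apply: sumr_ge0 => i _; rewrite mxE -expr2 sqr_ge0.
Qed.

Lemma symmx_tensor (r : R) d : symmx (r *: (d^T *m d)).
Proof. by rewrite /symmx linearZ /= trmx_mul trmxK. Qed.

Lemma psdmx_tensor (r : R) d : 0 <= r -> psdmx (r *: (d^T *m d)).
Proof.
move=> r0 v; rewrite -scalemxAr -scalemxAl mxE mulr_ge0 //.
have -> : v *m (d^T *m d) *m v^T = (v *m d^T) *m (d *m v^T).
  by rewrite !mulmxA.
(* The two factors are mutually transposed matrices of size one, so their product is a square. *)
rewrite [v *m d^T]mx11_scalar [d *m v^T]mx11_scalar.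
rewrite -scalar_mxM mxE /= mulr1n.
have -> : (d *m v^T) 0 0 = (v *m d^T) 0 0.
  by rewrite -[d *m _]trmxK mxE trmx_mul trmxK.
by rewrite -expr2 sqr_ge0.
Qed.

Lemma trace_tensor (r : R) d : \tr (r *: (d^T *m d)) = r * dot d d.
Proof.
rewrite mxtraceZ mxtrace_mulC; congr (_ * _).
rewrite /mxtrace big_ord1 mxE; apply: eq_bigr => i _.
by rewrite mxE.
Qed.

(* The scalar inequality that a viscosity subsolution satisfies wherever it is
   touched from above by a constant minus the barrier; supersolutions yield it
   for [- u]. *)
Definition barrier_sub (E : set (spt R n)) (lam Lam : R) (b c : spt R n -> R)
    (u : spt R n -> R) : Prop :=
  forall (a k : 'rV[R]_n) (t1 rho al eps kap : R) z (d := disp a k t1 z)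
    (g := gap a k t1 rho z),
  E z -> 0 <= eps -> 0 <= g ->
  (\forall w \near z, E w -> u w + barrier a k t1 rho al eps kap w
                         <= u z + barrier a k t1 rho al eps kap z) ->
  0 <= eps * decay t1 al z * (4 * Lam * n%:R * g - 8 * lam * dot d d
                              + 4 * b z * g * enorm d)
       + c z * u z + barrier_dt a k t1 rho al eps kap z.

Variables (E : set (spt R n)) (F : spt R n -> R -> 'rV[R]_n -> 'M[R]_n -> R).
Variables (lam Lam : R) (b c : spt R n -> R).
Hypothesis FS : structure_S E F lam Lam b c.
Hypothesis F0 : forall z, E z -> F z 0 0 0 = 0.

Lemma barrierN (a k : 'rV[R]_n) (t1 rho al eps kap : R) z :
  barrier a k t1 rho al (- eps) (- kap) z = - barrier a k t1 rho al eps kap z.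
Proof. rewrite /barrier; ring. Qed.

Lemma grad_barrier (a k : 'rV[R]_n) (t1 rho al eps kap : R) z :
  grad (barrier a k t1 rho al eps kap) z =
  (- 4 * eps * decay t1 al z * gap a k t1 rho z) *: disp a k t1 z.
Proof. by apply/rowP => i; rewrite mxE dx_barrier /barrier_dx [RHS]mxE. Qed.

Lemma hess_barrier (a k : 'rV[R]_n) (t1 rho al eps kap : R) z :
  hess (barrier a k t1 rho al eps kap) z =
  (8 * eps * decay t1 al z) *: ((disp a k t1 z)^T *m disp a k t1 z)
  - (4 * eps * decay t1 al z * gap a k t1 rho z)%:M.
Proof.
apply/matrixP => i j; rewrite mxE dxx_barrier /barrier_dxx.
move: (disp a k t1 z) (gap a k t1 rho z) => d g.
rewrite [RHS]mxE [X in _ = X + _]mxE [X in _ = _ + X]mxE.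
rewrite [(_ *m _) _ _]mxE big_ord1 !mxE -mulr_natr; ring.
Qed.

(** The test function is [- W], a barrier with [eps] and [kap] negated. In its Hessian the scalar
    matrix is the positive part and the tensor the negative one, so the upper extremal bound pairs
    [Lam] with the former and [lam] with the latter. *)
Lemma visc_sub_barrier_sub (u : spt R n -> R) :
  visc_sub E F u -> barrier_sub E lam Lam b c u.
Proof.
move=> su a k t1 rho al eps kap z d g Ez e0 g0 H.
have th0 : 0 <= decay t1 al z by exact: expR_ge0.
have := su z (barrier a k t1 rho al (- eps) (- kap)) Ez
  (C21_near_barrier _ _ _ _ _ _ _ _).
rewrite /touches_above.
have T : \forall w \near z, E w ->
    u w - barrier a k t1 rho al (- eps) (- kap) w <=
    u z - barrier a k t1 rho al (- eps) (- kap) z.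
  by apply: filterS H => w Hw Ew; rewrite !barrierN !opprK; exact: Hw.
move=> /(_ T); rewrite grad_barrier hess_barrier dt_barrier -/d -/g.
set th := decay t1 al z in th0 *.
have -> : (8 * - eps * th) *: (d^T *m d) - (4 * - eps * th * g)%:M =
    (4 * eps * th * g)%:M - (8 * eps * th) *: (d^T *m d).
  by rewrite !(mulrN, mulNr) scaleNr raddfN /= opprK addrC.
have -> : - 4 * - eps * th * g = 4 * eps * th * g by ring.
have h1 : 0 <= 4 * eps * th * g by rewrite !mulr_ge0.
have h2 : 0 <= 8 * eps * th by rewrite !mulr_ge0.
have [_] := extremal_bounds FS F0 (u z)
  ((4 * eps * th * g) *: d) Ez (symmx_scalar _) (psdmx_scalar h1)
  (symmx_tensor (8 * eps * th) d) (psdmx_tensor d h2).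
rewrite enormZ // trace_tensor mxtrace_scalar -mulr_natr /barrier_dt -/d -/g -/th.
move: (F _ _ _ _) => f; lra.
Qed.

(** Here [W] itself touches [u] from below, the two parts of the Hessian trade roles, and the lower
    extremal bound is used; a change of sign gives the inequality for [- u]. *)
Lemma visc_super_barrier_sub (u : spt R n -> R) :
  visc_super E F u -> barrier_sub E lam Lam b c (fun z => - u z).
Proof.
move=> su a k t1 rho al eps kap z d g Ez e0 g0 H.
have th0 : 0 <= decay t1 al z by exact: expR_ge0.
have := su z (barrier a k t1 rho al eps kap) Ez
  (C21_near_barrier _ _ _ _ _ _ _ _).
rewrite /touches_below.
have T : \forall w \near z, E w ->
    u z - barrier a k t1 rho al eps kap z <=
    u w - barrier a k t1 rho al eps kap w.
  by apply: filterS H => w Hw Ew; move: (Hw Ew); lra.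
move=> /(_ T); rewrite grad_barrier hess_barrier dt_barrier -/d -/g.
set th := decay t1 al z in th0 *.
have h1 : 0 <= 4 * eps * th * g by rewrite !mulr_ge0.
have h2 : 0 <= 8 * eps * th by rewrite !mulr_ge0.
have [] := extremal_bounds FS F0 (u z)
  ((- 4 * eps * th * g) *: d) Ez (symmx_tensor (8 * eps * th) d)
  (psdmx_tensor d h2) (symmx_scalar _) (psdmx_scalar h1).
have -> : enorm ((- 4 * eps * th * g) *: d) = 4 * eps * th * g * enorm d.
  rewrite -enormZ // !enormE; congr Num.sqrt.
  by rewrite !dotZl !dotZr; ring.
rewrite trace_tensor mxtrace_scalar -mulr_natr /barrier_dt -/d -/g -/th.
move: (F _ _ _ _) => f; lra.
Qed.

End BarrierTest.

(** * Compactness of slanted tubes and strictness of the barrier *)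

Section Tube.
Variables (R : realType) (n : nat) (a k : 'rV[R]_n) (t1 rho : R).
Implicit Types (z w : spt R n).

Definition tube (t2 : R) : set (spt R n) :=
  [set z | [/\ t1 <= z.2, z.2 <= t2 & 0 <= gap a k t1 rho z]].

Lemma sqr_coord_le (x : 'rV[R]_n) i : x ord0 i ^+ 2 <= dot x x.
Proof.
rewrite /dot (bigD1 i) //= -expr2 lerDl; apply: sumr_ge0 => j _.
by rewrite -expr2 sqr_ge0.
Qed.

Lemma tube_compact (t2 : R) : 0 <= rho -> compact (tube t2).
Proof.
move=> rho0.
(* A coordinate of a point of the tube splits into its offset, at most [rho], the base point [a],
   and the drift of the axis over a time of at most [t2 - t1]. *)
pose B i := rho + `|a ord0 i| + (t2 - t1) * `|k ord0 i|.
pose box : set (spt R n) :=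
  [set v : 'rV[R]_n | forall i, [set` `[- B i, B i]] (v ord0 i)] `*` [set` `[t1, t2]].
apply: (@subclosed_compact _ _ box).
- have -> : tube t2 = (snd @^-1` [set r : R | t1 <= r]) `&`
      ((snd @^-1` [set r : R | r <= t2]) `&`
      (gap a k t1 rho @^-1` [set r : R | 0 <= r])).
    by apply/seteqP; split => z; [case => ? ? ? | case => ? [? ?]].
  have csnd : continuous (snd : spt R n -> R) by move=> z; exact: cvg_snd.
  apply: closedI; first exact: (closed_comp (fun z _ => csnd z) (@closed_ge _ t1)).
  apply: closedI; first exact: (closed_comp (fun z _ => csnd z) (@closed_le _ t2)).
  exact: (closed_comp (fun z _ => @continuous_gap _ _ a k t1 rho z)
    (@closed_ge _ 0)).
- apply: compact_setX; last exact: segment_compact.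
  apply: (@rV_compact R n (fun i => `[- B i, B i]%classic)) => i.
  exact: segment_compact.
- move=> z [tz1 tz2 gz]; split => /=; last by rewrite in_itv /= tz1 tz2.
  move=> i; rewrite in_itv /= -ler_norml /B.
  have di : `|disp a k t1 z ord0 i| <= rho.
    rewrite -(ler_pXn2r (n := 2)) ?nnegrE // real_normK ?num_real //.
    apply: le_trans (sqr_coord_le _ _) _.
    by move: gz; rewrite /gap subr_ge0.
  have -> : z.1 ord0 i = disp a k t1 z ord0 i + a ord0 i
      + (z.2 - t1) * k ord0 i by rewrite /disp !mxE; ring.
  apply: le_trans (ler_normD _ _) _; apply: lerD.
    apply: le_trans (ler_normD _ _) _; exact: lerD.
  rewrite normrM ler_wpM2r // ger0_norm; lra.
Qed.

End Tube.

(* The condition on [al] makes the discriminant of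
   [al g^2 - C g + 8 lam rho^2] negative. *)
Lemma barrier_strict (R : realFieldType)
    (lam Lam K rho N kk g bz cz uz s q X kap C al : R) :
  C = 4 * Lam * N + 8 * lam + 4 * K * rho + K * rho ^+ 2
      + 2 * (rho ^+ 2 + kk) ->
  2 * (8 * lam * rho ^+ 2) * al = C ^+ 2 ->
  0 < lam -> 0 < rho -> 0 <= g -> g <= rho ^+ 2 -> 0 <= bz <= K ->
  - K <= cz <= 0 -> 0 <= s <= rho -> q <= (rho ^+ 2 + kk) / 2 -> 0 < X ->
  0 <= kap -> - (X * g ^+ 2) <= uz ->
  X * (4 * Lam * N * g - 8 * lam * (rho ^+ 2 - g) + 4 * bz * g * s)
    + cz * uz + (X * (- al * g ^+ 2 + 4 * g * q) - kap) < 0.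
Proof.
move=> CE alE lam0 rho0 g0 gr /andP[b0 bK] /andP[cK c0] /andP[s0 sr].
move=> q0 X0 kap0 h1; have K0 : 0 <= K := le_trans b0 bK.
(* As [cz <= 0], a lower bound on [uz] suffices; one factor [g] is estimated by [rho ^+ 2] to leave
   a term linear in [g]. *)
have cu : cz * uz <= X * (K * rho ^+ 2 * g).
  have h2 : 0 <= X * g ^+ 2 by rewrite mulr_ge0 ?sqr_ge0 // ltW.
  have h3 : cz * uz <= - cz * (X * g ^+ 2).
    by rewrite mulNr -mulrN ler_wnM2l.
  have h4 : - cz * (X * g ^+ 2) <= K * (X * g ^+ 2).
    by apply: ler_wpM2r => //; lra.
  apply: le_trans h3 (le_trans h4 _).
  rewrite mulrCA -mulrA ler_pM2l // ler_wpM2l //.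
  by rewrite expr2 ler_wpM2r.
have bs : 4 * bz * g * s <= 4 * K * rho * g.
  have : bz * s <= K * rho by apply: ler_pM.
  move=> /(ler_wpM2r g0); lra.
have gq : 4 * g * q <= 2 * (rho ^+ 2 + kk) * g.
  move: (ler_wpM2r g0 q0); lra.
have m0 : 0 < 8 * lam * rho ^+ 2 by rewrite !mulr_gt0 // exprn_gt0.
(* [C] collects the coefficients of all terms that are linear in [g]. *)
have YZ : 4 * Lam * N * g - 8 * lam * (rho ^+ 2 - g) + 4 * bz * g * s
    + (- al * g ^+ 2 + 4 * g * q) + K * rho ^+ 2 * g
    <= C * g - 8 * lam * rho ^+ 2 - al * g ^+ 2.
  rewrite CE; clear - bs gq; lra.
have neg : C * g - 8 * lam * rho ^+ 2 - al * g ^+ 2 < 0.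
  move: (8 * lam * rho ^+ 2) m0 alE => m m0 alE.
  have : 0 < 2 * m * (al * g ^+ 2 - C * g + m).
    have -> : 2 * m * (al * g ^+ 2 - C * g + m) = (C * g - m) ^+ 2 + m ^+ 2.
      rewrite mulrDr mulrBr mulrA alE; ring.
    by rewrite ltr_wpDl ?sqr_ge0 // exprn_gt0.
  by rewrite pmulr_rgt0; lra.
have := le_lt_trans YZ neg; rewrite -(pmulr_rlt0 _ X0).
clear - cu kap0; lra.
Qed.

(** * The maximum principle in a single tube *)

Section Propagation.
Variables (R : realType) (n : nat) (E : set (spt R n)).
Variables (lam Lam K : R) (b c u : spt R n -> R) (M : R).
Hypothesis lam_gt0 : 0 < lam.
Hypothesis b_bound : forall z, E z -> 0 <= b z <= K.
Hypothesis c_bound : forall z, E z -> - K <= c z <= 0.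
Hypothesis u_sub : barrier_sub E lam Lam b c u.
Hypothesis u_cont : {within E, continuous u}.
Hypothesis M_ge0 : 0 <= M.
Hypothesis u_le : forall z, E z -> u z <= M.

Variables (a k : 'rV[R]_n) (t1 rho : R).
Hypothesis rho_gt0 : 0 < rho.

(** [C] and [al] solve the two equations assumed in [barrier_strict], with the squared slope of the
    axis as [kk]. *)
Let C := 4 * Lam * n%:R + 8 * lam + 4 * K * rho + K * rho ^+ 2
         + 2 * (rho ^+ 2 + dot k k).
Let al := C ^+ 2 / (16 * lam * rho ^+ 2).

Let gap_le z : gap a k t1 rho z <= rho ^+ 2.
Proof. by rewrite /gap gerBl dot_ge0. Qed.

(** From [M < u z + W z] and [0 <= M], the value [u z] exceeds minus the positive term of the
    barrier. This is the lower bound under which [barrier_strict] contradicts the viscosity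
    inequality. *)
Let no_touching (eps kap : R) z (W := barrier a k t1 rho al eps kap) :
  E z -> 0 < eps -> 0 <= kap -> t1 <= z.2 -> 0 <= gap a k t1 rho z ->
  M < u z + W z ->
  ~ (\forall w \near z, E w -> u w + W w <= u z + W z).
Proof.
move=> Ez e0 k0 tz g0 uW H; have := u_sub Ez (ltW e0) g0 H.
have th0 : 0 < decay t1 al z by exact: expR_gt0.
have X0 : 0 < eps * decay t1 al z by rewrite mulr_gt0.
have dE : dot (disp a k t1 z) (disp a k t1 z) = rho ^+ 2 - gap a k t1 rho z.
  by rewrite /gap; ring.
have dr : dot (disp a k t1 z) (disp a k t1 z) <= rho ^+ 2.
  by rewrite dE gerBl.
apply/negP; rewrite -ltNge /barrier_dt dE.
apply: (barrier_strict (C := C) (kk := dot k k) (rho := rho) (K := K)) => //.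
- by rewrite /al; field; rewrite !gt_eqF.
- exact: b_bound.
- exact: c_bound.
- by rewrite sqrtr_ge0 enorm_le // ltW.
- apply: le_trans (dot_le_half _ _) _; rewrite ler_pM2r //; exact: lerD.
- have kt : 0 <= kap * (z.2 - t1) by rewrite mulr_ge0 // subr_ge0.
  move: uW kt; rewrite /W /barrier.
  move: (kap * _) (_ * gap _ _ _ _ _ ^+ 2) (u z) => r X v.
  by move: M_ge0; lra.
Qed.

(** A maximum point of [u + W] over the tube is shown to be a local maximum relative to [E], against
    [no_touching]. The disjunction separates a tube continued beyond [t0] from one at whose top [E]
    ends. *)
Lemma tube_propagation (t0 t2 e0 : R) : t1 < t0 -> t0 <= t2 -> 0 < e0 ->
  tube a k t1 rho t2 `<=` E ->
  (t0 < t2 \/ forall z, tube a k t1 rho t2 z -> z.2 = t2 ->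
     \forall w \near z, E w -> w.2 <= t2) ->
  (forall z, tube a k t1 rho t2 z -> z.2 = t1 -> u z <= M - e0) ->
  forall z0, z0.2 = t0 -> disp a k t1 z0 = 0 -> u z0 < M.
Proof.
move=> t10 t02 e0_gt0 TE top bot z0 z0t z0d.
rewrite ltNge; apply/negP => Mu.
have r4 : 0 < rho ^+ 4 by exact: exprn_gt0.
(* With [eps] equal to [e0 / rho ^+ 4], the positive term of [W] at time [s] equals [f s] on the
   axis and is at most [f s] in the tube. *)
pose f (s : R) := e0 * expR (- al * (s - t1)).
have f0 s : 0 < f s by rewrite mulr_gt0 ?expR_gt0.
have al0 : 0 <= al.
  by rewrite divr_ge0 ?sqr_ge0 // !mulr_ge0 ?sqr_ge0 // ltW.
have fdec : f t2 <= f t0.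
  rewrite /f ler_pM2l // ler_expR; apply: ler_wnM2l; lra.
(* [kap] pushes the barrier to at most 0 at the top [t2] of the tube but keeps it
   positive at [z0]; this is only possible, and only needed, if [t0 < t2]. *)
have [kap [k0 kz0 ktop]] : exists kap : R, [/\ 0 <= kap,
    kap * (t0 - t1) < f t0 &
    f t2 <= kap * (t2 - t1) \/ forall z, tube a k t1 rho t2 z -> z.2 = t2 ->
     \forall w \near z, E w -> w.2 <= t2].
  case: top => top; last first.
    by exists 0; split; [|rewrite mul0r|right].
  have t21 : 0 < t2 - t1 by lra.
  exists (f t2 / (t2 - t1)); split.
  - by rewrite divr_ge0 // ltW.
  - apply: lt_le_trans fdec.
    by rewrite mulrAC ltr_pdivrMr // ltr_pM2l //; lra.
  - by left; rewrite divfK ?gt_eqF.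
pose eps := e0 / rho ^+ 4; have eps0 : 0 < eps by rewrite divr_gt0.
pose W := barrier a k t1 rho al eps kap.
have Wle z : 0 <= gap a k t1 rho z -> W z <= f z.2 - kap * (z.2 - t1).
  move=> g0; rewrite /W /barrier lerD2r /f /decay /eps.
  rewrite -mulrA [X in _ * X]mulrC mulrA ler_wpM2r ?expR_ge0 //.
  rewrite -mulrA ger_pMr // mulrC ler_pdivrMr // mul1r.
  rewrite (_ : 4 = 2 * 2)%N // exprM ler_pXn2r ?nnegrE ?sqr_ge0 //.
have Wz0 : W z0 = f t0 - kap * (t0 - t1).
  rewrite /W /barrier /gap z0d /decay z0t (_ : dot _ _ = 0); last first.
    by rewrite -(scale0r 0) dotZl mul0r.
  rewrite /f /eps subr0; congr (_ - _); field; exact: lt0r_neq0.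
have Tz0 : tube a k t1 rho t2 z0.
  split; rewrite ?z0t //; first exact: ltW.
  rewrite /gap z0d (_ : dot _ _ = 0) ?subr0 ?sqr_ge0 //.
  by rewrite -(scale0r 0) dotZl mul0r.
have cW : continuous W by exact: continuous_barrier.
have [zm /set_mem Tzm max] : exists2 zm, zm \in tube a k t1 rho t2 &
    forall z, z \in tube a k t1 rho t2 -> u z + W z <= u zm + W zm.
  apply: (@compact_EVT_max _ R (fun z => u z + W z)).
  - by exists z0.
  - exact: tube_compact (ltW rho_gt0).
  - apply: within_continuousD; first exact: continuous_subspaceW TE u_cont.
    exact: continuous_subspaceT.
have Ezm := TE _ Tzm; case: (Tzm) => [tm1 tm2 gm].
have big : M < u zm + W zm.
  apply: lt_le_trans (max z0 (mem_set Tz0)); rewrite Wz0; lra.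
have Wm : 0 < W zm by move: (u_le Ezm); lra.
have kt : 0 <= kap * (zm.2 - t1) by rewrite mulr_ge0 // subr_ge0.
(* On the lateral boundary [W <= 0]; at the bottom [W <= e0], which the deficit of [u] there
   compensates. Neither allows [u + W] to exceed [M]. *)
have gm' : 0 < gap a k t1 rho zm.
  rewrite lt_neqAle gm andbT; apply/eqP => g0.
  by move: Wm; rewrite /W /barrier -g0 expr0n mulr0; lra.
have tm1' : t1 < zm.2.
  rewrite lt_neqAle tm1 andbT; apply/eqP => t1m.
  have := bot _ Tzm (esym t1m); have := Wle _ gm.
  by rewrite /f -t1m subrr !mulr0 expR0; lra.
apply: (@no_touching eps kap zm) => //.
(* The last constraint of the tube: once it holds for points of [E] near [zm], these all lie in the
   tube, where [zm] is maximal. *)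
have near_top : \forall w \near zm, E w -> w.2 <= t2.
  have [tm2'|tm2'] := eqVneq zm.2 t2.
    case: ktop => [ktop|]; last exact.
    by exfalso; move: (Wle _ gm) Wm; rewrite tm2'; lra.
  have {}tm2' : zm.2 < t2 by rewrite lt_neqAle tm2'.
  near=> w => _; apply: ltW; near: w.
  by apply: (cvgr_lt zm.2); [exact: cvg_snd|].
near=> w => Ew; apply: max; apply: mem_set; split.
- apply: ltW; near: w; by apply: (cvgr_gt zm.2); [exact: cvg_snd|].
- by move: Ew; near: w.
- apply: ltW; near: w.
  by apply: (cvgr_gt (gap a k t1 rho zm)); [exact: continuous_gap|].
Unshelve. all: by end_near.
Qed.

End Propagation.

(** * Neighbourhoods of upper-base points and of thin tubes *)

Section Geometry.
Variables (R : realType) (n : nat).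
Implicit Types (x y : 'rV[R]_n) (z w : spt R n).

(** Each coordinate is bounded by the Euclidean norm, so Euclidean balls fit in the sup-norm balls
    of the ambient topology. *)
Lemma dot_le_ball x y (r e : R) :
  0 <= r -> r < e -> dot (y - x) (y - x) <= r ^+ 2 -> ball x e y.
Proof.
move=> r0 re xy; split => [|i j]; first exact: le_lt_trans re.
rewrite (ord1 i) -ball_normE /= distrC.
apply: le_lt_trans re; rewrite -(ler_pXn2r (n := 2)) ?nnegrE //.
rewrite real_normK ?num_real //; apply: le_trans xy.
by have := sqr_coord_le (y - x) j; rewrite !mxE.
Qed.

Lemma near_enorm x w (h : R) : 0 < h -> enorm (w.1 - x) < h ->
  \forall w' \near w, enorm (w'.1 - x) < h.
Proof.
move=> h0; rewrite enorm_lt // => wh.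
have : \forall w' \near w, dot (w'.1 - x) (w'.1 - x) < h ^+ 2.
  have c1 : {for w, continuous (fun w : spt R n => w.1 - x)}.
    by apply: cvgB; [exact: cvg_fst | exact: cvg_cst].
  exact: cvgr_lt (continuous_dot_comp c1 c1) _ wh.
by apply: filterS => w'; rewrite -enorm_lt.
Qed.

Lemma near_time_lt w (t : R) : w.2 < t -> \forall w' \near w, w'.2 < t.
Proof. exact: (@cvgr_lt R _ (nbhs w) _ snd w.2 cvg_snd). Qed.

Lemma near_time_gt w (t : R) : t < w.2 -> \forall w' \near w, t < w'.2.
Proof. exact: (@cvgr_gt R _ (nbhs w) _ snd w.2 cvg_snd). Qed.

Variables (D : set (spt R n)).
Let E := D `|` upper_base D.

(** The cylinder is open and [E] lies in the closure of [D], so a point of [E] in it would bring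
    points of [D] with it. *)
Lemma not_above_upper_base x (h s : R) w : 0 < h ->
  cyl x h s (s + h) `<=` ~` D -> E w -> ~ cyl x h s (s + h) w.
Proof.
move=> h0 CD [Dw /CD //|[cw _]] [wx /andP[ws wsh]].
have [w' [Dw' Cw']] : D `&` cyl x h s (s + h) !=set0.
  apply: cw; near=> w'; split.
    by near: w'; exact: near_enorm.
  by apply/andP; split; near: w'; [exact: near_time_gt | exact: near_time_lt].
exact: CD Cw' Dw'.
Unshelve. all: by end_near.
Qed.

(** The vertical line through [w] meets [D] just below [w] and its complement just above; smaller
    cylinders at [w] fit in those of [z]. *)
Lemma upper_base_slice z w (h : R) : 0 < h ->
  cyl z.1 h (z.2 - h) z.2 `<=` D -> cyl z.1 h z.2 (z.2 + h) `<=` ~` D ->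
  enorm (w.1 - z.1) < h -> w.2 = z.2 -> upper_base D w.
Proof.
move=> h0 lowD upD wz wt.
have line : continuous (fun t : R => (w.1, t) : spt R n).
  by move=> t; apply: (@cvg_pair _ _ _ (nbhs t) (nbhs w.1) (nbhs t) _ _ _
    (fun=> w.1) id); [exact: cvg_cst | exact: cvg_id].
have cw : w = (w.1, w.2) by case: (w).
split; last split.
- move=> B Bw; have : \forall t \near w.2^'-, B (w.1, t).
    by apply: cvg_within; apply: (line w.2); rewrite /= -cw.
  move=> nB; near w.2^'- => t.
  exists (w.1, t); split; last by near: t.
  apply: lowD; split => //=; rewrite -wt.
  by apply/andP; split; near: t; [apply: nbhs_left_gt; lra | exact: nbhs_left_lt].
- move=> iw; have nD : \forall t \near w.2^'+, D (w.1, t).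
    by apply: cvg_within; apply: (line w.2); rewrite /= -cw.
  near w.2^'+ => t.
  apply: (upD (w.1, t)); last by near: t.
  split => //=; rewrite -wt.
  by apply/andP; split; near: t; [exact: nbhs_right_gt | apply: nbhs_right_lt; lra].
- have := near_enorm h0 wz => /nbhs_ballP[d /= d0 bd].
  have xin x (r : R) : r <= d / 2 -> enorm (x - w.1) < r -> enorm (x - z.1) < h.
    move=> rd xr; have r0 : 0 < r by apply: le_lt_trans xr; exact: sqrtr_ge0.
    apply: (bd (x, w.2)); split => /=; last exact: ballxx.
    apply: (@dot_le_ball _ _ r); [lra|lra|].
    by move: xr; rewrite enorm_lt // => /ltW.
  (* The bound [d / 2] keeps the new cylinders inside the old ones in space, the bound [h] in
     time. *)
  exists (Num.min h (d / 2)); first by rewrite lt_min h0 divr_gt0.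
  set r := Num.min _ _; have [rh rd] : r <= h /\ r <= d / 2.
    by split; rewrite ge_min lexx ?orbT.
  split=> w' [/(xin _ _ rd) w'x /andP[]]; rewrite wt => tl tr.
    by apply: lowD; split => //; apply/andP; split => //; lra.
  by apply: upD; split => //; apply/andP; split => //; lra.
Unshelve. all: by end_near.
Qed.

(** Earlier points nearby lie in the lower cylinder, simultaneous ones on the upper base itself. *)
Lemma near_upper_base z : upper_base D z ->
  \forall w \near z, w.2 <= z.2 -> E w.
Proof.
move=> [_ [_ [h h0 [low up]]]].
have z0 : enorm (z.1 - z.1) < h by rewrite subrr enorm0.
near=> w.
have wz : enorm (w.1 - z.1) < h by near: w; exact: near_enorm.
have wh : z.2 - h < w.2 by near: w; apply: near_time_gt; lra.
rewrite le_eqVlt => /orP[/eqP wt|wt].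
  by right; exact: upper_base_slice low up wz wt.
by left; apply: low; split => //; apply/andP.
Unshelve. all: by end_near.
Qed.

Variables (a k : 'rV[R]_n) (t1 : R).

Definition axis (t : R) : spt R n := (a + (t - t1) *: k, t).

Lemma continuous_axis : continuous axis.
Proof.
move=> t; apply: (@cvg_pair _ _ _ (nbhs t) (nbhs (axis t).1) (nbhs t) _ _ _
  (fun t => (axis t).1) id); last exact: cvg_id.
apply: cvgD; first exact: cvg_cst.
by apply: cvgZr_tmp; apply: cvgB; [exact: cvg_id | exact: cvg_cst].
Qed.

Lemma disp_axis z : disp a k t1 z = z.1 - (axis z.2).1.
Proof. by rewrite /disp /= opprD addrA. Qed.

(** The radius of a ball around [axis t] is shared between the motion of the axis and the width of
    the slice. The joint filter is the form that a compactness argument in [t] consumes. *)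
Lemma near_tube_slice (t : R) (P : set (spt R n)) :
  (\forall w \near axis t, P w) ->
  \forall t' \near t & rho \near 0^'+,
    forall z, z.2 = t' -> 0 <= gap a k t1 rho z -> P z.
Proof.
move=> /nbhs_ballP[e /= e0 eP].
have e2 : 0 < e / 2 by rewrite divr_gt0.
have nt : \forall t' \near t, ball (axis t) (e / 2) (axis t').
  exact: (@continuous_axis t _ (nbhsx_ballx _ _ e2)).
near=> t' rho => z zt gz.
have rho0 : 0 < rho by near: rho; exact: nbhs_right_gt.
have rhoe : rho < e / 2 by near: rho; exact: nbhs_right_lt.
have [b1 b2] : ball (axis t) (e / 2) (axis t') by near: t'.
apply: eP; rewrite (splitr e); apply: (ball_triangle (y := axis t')); first by split.
split => /=; last by rewrite zt; exact: ballxx.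
apply: (dot_le_ball (ltW rho0) rhoe).
by move: gz; rewrite /gap subr_ge0 disp_axis zt.
Unshelve. all: by end_near.
Qed.

(** Compactness of the time interval turns the radii admissible near each time into a common one. *)
Lemma near_tube_sub (t2 : R) :
  (forall t, t1 <= t <= t2 -> \forall w \near axis t, w.2 <= t2 -> E w) ->
  \forall rho \near 0^'+, tube a k t1 rho t2 `<=` E.
Proof.
move=> H; pose P (rho t : R) :=
  forall z, z.2 = t -> 0 <= gap a k t1 rho z -> z.2 <= t2 -> E z.
have : \forall rho \near 0^'+, [set` `[t1, t2]] `<=` P rho.
  have /compact_near_coveringP := @segment_compact R t1 t2; apply => t /=.
  rewrite in_itv /= => tt; exact: near_tube_slice (H t tt).
apply: filterS => rho Prho z [z1 z2 gz].
by apply: (Prho z.2) => //=; rewrite in_itv /= z1 z2.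
Qed.

End Geometry.

(** * Propagation along segments and broken lines *)

Section Subordinate.
Variables (R : realType) (n : nat) (D : set (spt R n)).
Hypothesis D_open : open D.
Let E := D `|` upper_base D.

Lemma segE (z0 z1 : spt R n) (l : R) : seg z0 z1 l = l *: (z1 - z0) + z0.
Proof.
rewrite /seg; congr (_, _) => /=; last by rewrite scaleRE; ring.
by apply/rowP => i; rewrite !mxE; ring.
Qed.

Lemma continuous_seg (z0 z1 : spt R n) : continuous (seg z0 z1).
Proof.
have -> : seg z0 z1 = (fun l => l *: (z1 - z0) + z0).
  by apply/funext => l; rewrite segE.
by move=> l; apply: cvgD; [apply: cvgZr_tmp; exact: cvg_id | exact: cvg_cst].
Qed.

(* Just above a point of the upper base there is no point of [E], while a
   segment with decreasing time continues above each of its non-initial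
   points. *)
Lemma seg_in_domain (z0 z1 : spt R n) : z1.2 < z0.2 ->
  (forall l, 0 < l <= 1 -> E (seg z0 z1 l)) ->
  forall l, 0 < l <= 1 -> D (seg z0 z1 l).
Proof.
move=> z10 segE l l01; have /andP[l0 l1] := l01.
case: (segE l l01) => // -[_ [_ [h h0 [_ up]]]].
set w := seg z0 z1 l in up.
have nl (P : set (spt R n)) : (\forall w' \near w, P w') ->
    \forall l' \near l^'-, P (seg z0 z1 l').
  by move=> Pw; apply: cvg_within; exact: (@continuous_seg z0 z1 l).
have n1 : \forall l' \near l^'-, enorm ((seg z0 z1 l').1 - w.1) < h.
  apply: (nl [set w' | enorm (w'.1 - w.1) < h]).
  by apply: near_enorm => //; rewrite subrr enorm0.
have n2 : \forall l' \near l^'-, (seg z0 z1 l').2 < w.2 + h.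
  by apply: (nl [set w' | w'.2 < w.2 + h]); apply: near_time_lt; lra.
exfalso; near l^'- => l'.
have ll : l' < l by near: l'; exact: nbhs_left_lt.
have l'0 : 0 < l' by near: l'; exact: nbhs_left_gt.
apply: (not_above_upper_base (w := seg z0 z1 l') h0 up).
  by apply: segE; rewrite l'0; lra.
split; first by near: l'.
apply/andP; split; last by near: l'.
have : 0 < (l - l') * (z0.2 - z1.2) by rewrite mulr_gt0 // subr_gt0.
by rewrite /w /seg /=; lra.
Unshelve. all: by end_near.
Qed.

Variables (lam Lam K : R) (b c u : spt R n -> R) (M : R).
Hypothesis lam_gt0 : 0 < lam.
Hypothesis b_bound : forall z, E z -> 0 <= b z <= K.
Hypothesis c_bound : forall z, E z -> - K <= c z <= 0.
Hypothesis u_sub : barrier_sub E lam Lam b c u.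
Hypothesis u_cont : {within E, continuous u}.
Hypothesis M_ge0 : 0 <= M.
Hypothesis u_le : forall z, E z -> u z <= M.

Lemma segment_propagation (z0 z1 : spt R n) : z1.2 < z0.2 -> E z0 ->
  (forall l, 0 < l <= 1 -> D (seg z0 z1 l)) -> u z0 = M -> u z1 = M.
Proof.
move=> z10 Ez0 segD uz0; set t1 := z1.2 in z10; set t0 := z0.2 in z10.
have seg1 : seg z0 z1 1 = z1 by rewrite segE scale1r subrK.
have Dz1 : D z1 by rewrite -seg1; apply: segD; rewrite ltr01 lexx.
apply/eqP; rewrite eq_le u_le /=; last by left.
rewrite leNgt; apply/negP => uz1.
have t01 : 0 < t0 - t1 by rewrite subr_gt0.
have t01' : t0 - t1 != 0 by rewrite gt_eqF.
(* The segment is parametrised by time: the axis starts at [z1] and its slope takes it to [z0] at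
   time [t0]. *)
pose a := z1.1; pose k := (t0 - t1)^-1 *: (z0.1 - z1.1).
pose ax := axis a k t1.
have ax0 : ax t0 = z0.
  rewrite /ax /axis /k scalerA divff // scale1r addrC subrK.
  by rewrite /t0; case: (z0).
have ax1 : ax t1 = z1.
  by rewrite /ax /axis subrr scale0r addr0 /a /t1; case: (z1).
have axD t : t1 <= t < t0 -> D (ax t).
  move=> /andP[tt1 tt0]; pose l := (t0 - t) / (t0 - t1).
  have -> : ax t = seg z0 z1 l.
    rewrite /ax /axis /seg /k /a /l -/t0 -/t1; congr (_, _) => /=; last first.
      by field.
    by apply/rowP => i; rewrite !mxE; field.
  apply: segD; rewrite divr_gt0 ?subr_gt0 //= ler_pdivrMr // mul1r; lra.
have d0 : disp a k t1 z0 = 0 by rewrite disp_axis -/ax -/t0 ax0 subrr.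
have openD t t2 : D (ax t) -> \forall w \near ax t, w.2 <= t2 -> E w.
  move=> Dt; have : \forall w \near ax t, D w by exact: open_nbhs_nbhs.
  by apply: filterS => w Dw _; left.
pose e0 := (M - u z1) / 2; have e00 : 0 < e0 by rewrite divr_gt0 // subr_gt0.
have bot : \forall rho \near 0^'+, forall z, z.2 = t1 ->
    0 <= gap a k t1 rho z -> E z -> u z <= M - e0.
  have nu : \forall w \near ax t1, E w -> u w <= M - e0.
    rewrite ax1; have /subspace_continuousP/(_ z1 (or_introl Dz1)) := u_cont.
    move=> /cvgr_lt /(_ (M - e0)); rewrite near_withinE => H.
    have /H : u z1 < M - e0 by rewrite /e0; lra.
    by apply: filterS => w Hw Ew; apply: ltW; exact: Hw.
  have := near_tube_slice nu; case=> -[A B] [/= At Bt AB].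
  apply: filterS Bt => rho Brho z zt gz.
  by apply: (AB (t1, rho)) => //; split => //=; exact: nbhs_singleton.
(* It remains to choose the top [t2] of the tube, according to the position of [z0]. *)
suff [t2 t02 [axE top]] : exists2 t2, t0 <= t2 &
    (forall t, t1 <= t <= t2 -> \forall w \near ax t, w.2 <= t2 -> E w) /\
    (\forall rho \near 0^'+, t0 < t2 \/
      forall z, tube a k t1 rho t2 z -> z.2 = t2 ->
        \forall w \near z, E w -> w.2 <= t2).
  have TE := near_tube_sub axE.
  near (0 : R)^'+ => rho.
  have rho0 : 0 < rho by near: rho; exact: nbhs_right_gt.
  have TEr : tube a k t1 rho t2 `<=` E by near: rho.
  suff : u z0 < M by rewrite uz0 ltxx.
  apply: (tube_propagation lam_gt0 b_bound c_bound u_sub u_cont M_ge0 u_le rho0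
    _ t02 e00 TEr _ _ (erefl _) d0) => //.
  - by near: rho.
  - have br : forall z, z.2 = t1 -> 0 <= gap a k t1 rho z -> E z ->
        u z <= M - e0 by near: rho.
    by move=> z Tz zt; case: (Tz) => _ _ gz; apply: br => //; exact: TEr.
(* If [z0] lies in the open set [D], the axis stays in [D] for times within [e] of [t0], and the
   tube is prolonged by half of that. Otherwise it stops at [t0], and a radius below [h] keeps its
   top under a cylinder free of [E]. *)
case: (Ez0) => [Dz0|Uz0].
  have /(@continuous_axis _ _ a k t1 t0) /nbhs_ballP[e /= e_gt0 eD] :
    nbhs (ax t0) D by rewrite ax0; exact: open_nbhs_nbhs.
  exists (t0 + e / 2); first by rewrite lerDl ltW // divr_gt0.
  split; last by apply: nearW => rho; left; rewrite ltrDl divr_gt0.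
  move=> t /andP[tt1 tt2]; apply: openD.
  have [tt0|tt0] := ltP t t0; first by apply: axD; rewrite tt1.
  apply: eD; rewrite /= -ball_normE /= distrC ger0_norm; lra.
exists t0 => //; split.
  move=> t /andP[tt1]; rewrite le_eqVlt => /orP[/eqP ->|tt0].
    rewrite ax0; exact: near_upper_base.
  by apply: openD; apply: axD; rewrite tt1.
case: Uz0 => _ [_ [h h0 [_ up]]].
near=> rho; right => z [_ _ gz] zt.
have rho0 : 0 < rho by near: rho; exact: nbhs_right_gt.
have rhoh : rho < h by near: rho; exact: nbhs_right_lt.
have zh : enorm (z.1 - z0.1) < h.
  apply: le_lt_trans rhoh; apply: enorm_le; first exact: ltW.
  by move: gz; rewrite /gap subr_ge0 disp_axis -/ax zt ax0.
near=> w => Ew; rewrite leNgt; apply/negP => wt.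
apply: (not_above_upper_base h0 up Ew); split.
  by near: w; exact: near_enorm.
apply/andP; split=> //; near: w; apply: near_time_lt.
by rewrite zt /t0; lra.
Unshelve. all: by end_near.
Qed.

Lemma subordinate_propagation (z0 z : spt R n) : E z0 -> u z0 = M ->
  subordinate E z0 z -> u z = M.
Proof.
move=> Ez0 uz0 [m [v [v0 <- step]]].
(* The time bound makes the later points of the line earlier than [z0], hence different from it, as
   membership in [E] requires in [subordinate]. *)
suff H i : (i <= m)%N -> [/\ E (v i), u (v i) = M & (v i).2 <= z0.2].
  by case: (H m (leqnn m)).
elim: i => [|i IHi] im; first by rewrite v0.
have [Ei ui ti] := IHi (ltnW im); have [tS segE'] := step i im.
have seg0 l : 0 < l <= 1 -> E (seg (v i) (v i.+1) l).
  move=> /andP[l0 l1]; apply: segE'; first by rewrite ltW.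
  move=> /(congr1 snd) /= e.
  have : 0 < l * ((v i).2 - (v i.+1).2) by rewrite mulr_gt0 // subr_gt0.
  by lra.
have segD := seg_in_domain tS seg0; split.
- by have := seg0 1; rewrite segE scale1r subrK; apply; rewrite ltr01 lexx.
- exact: segment_propagation segD ui.
- by apply: ltW; exact: lt_le_trans ti.
Qed.

End Subordinate.

(** * The strong maximum and minimum principles *)

Unset Implicit Arguments.

Theorem theorem3p1 (R : realType) (n : nat) (D : set (spt R n))
  (F : spt R n -> R -> 'rV[R]_n -> 'M[R]_n -> R) (lam Lam : R)
  (b c : spt R n -> R) :
  open D -> connected D ->
  0 < lam -> lam <= Lam ->
  let E := D `|` upper_base D in
  (forall z, E z -> 0 <= b z) -> (forall z, E z -> c z <= 0) ->
  (exists K : R, forall z, E z -> `|b z| <= K /\ `|c z| <= K) ->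
  {within D, continuous b} -> {within D, continuous c} ->
  structure_S E F lam Lam b c ->
  (forall z, E z -> F z 0 0 0 = 0) ->
  (forall (u : spt R n -> R) (M : R) (z0 : spt R n),
     {within E, continuous u} -> visc_sub E F u ->
     E z0 -> u z0 = M -> 0 <= M -> (forall z, E z -> u z <= M) ->
     forall z, D z -> subordinate E z0 z -> u z = M)
  /\
  (forall (u : spt R n -> R) (M : R) (z0 : spt R n),
     {within E, continuous u} -> visc_super E F u ->
     E z0 -> u z0 = M -> M <= 0 -> (forall z, E z -> M <= u z) ->
     forall z, D z -> subordinate E z0 z -> u z = M).
Proof.
move=> Dop _ lam0 _ E b0 c0 [K bcK] _ _ FS F0.
have bK z : E z -> 0 <= b z <= K.
  move=> Ez; rewrite b0 //=; have [+ _] := bcK z Ez; exact/le_trans/ler_norm.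
have cK z : E z -> - K <= c z <= 0.
  move=> Ez; rewrite c0 // andbT; have [_ cz] := bcK z Ez.
  by move: cz; rewrite ler_norml => /andP[].
split=> u M z0 uc us Ez0 uz0 M0 uM z _ sz.
  have su := visc_sub_barrier_sub FS F0 us.
  exact: (subordinate_propagation Dop lam0 bK cK su uc M0 uM Ez0 uz0 sz).
(* The minimum principle is the propagation of the maximum [- M] of [- u]; as [barrier_sub] does not
   mention [F], no reflected operator is introduced. *)
have su := visc_super_barrier_sub FS F0 us.
have uc' : {within E, continuous (fun z => - u z)}.
  by move=> w; apply: cvgN; exact: uc.
apply: oppr_inj.
apply: (subordinate_propagation Dop lam0 bK cK su uc' _ _ Ez0 _ sz).
- by rewrite oppr_ge0.
- by move=> w Ew; rewrite lerN2; exact: uM.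
- by rewrite uz0.
Qed.
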